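(* The monoid $\mathrm{Emb}_<(\mathbb{N})$ of order-preserving embeddings (i.e. strictly increasing maps) $\mathbb{N}\to\mathbb{N}$, under composition, is acyclic and boundedly acyclic.
   Context: The monoid is regarded as an abstract (discrete) monoid. Multiplication is written in terms of the right action on $\mathbb{N}$: the product $\eta\zeta$ is the embedding obtained by applying $\eta$ first and then $\zeta$. For a discrete monoid $M$, its nerve is the semisimplicial set with $M^k$ as set of $k$-simplices and face maps $d_0(g_1,\dots,g_k)=(g_2,\dots,g_k)$, $d_i(g_1,\dots,g_k)=(g_1,\dots,g_ig_{i+1},\dots,g_k)$ for $0<i<k$, $d_k(g_1,\dots,g_k)=(g_1,\dots,g_{k-1})$. $M$ is acyclic if the integral homology $H_k(M;\mathbb{Z})$ of its nerve vanishes for all $k>0$. The bounded cohomology $H^k_b(M)$ is the cohomology of the complex $0\to\ell^\infty(M^0)\to\ell^\infty(M^1)\to\ell^\infty(M^2)\to\cdots$ of bounded real-valued functions, with coboundary dual to the alternating sum of the face maps, and $M$ is boundedly acyclic if $H^k_b(M)=0$ for all $k>0$. *)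

(* Defs.v *)
From HB Require Import structures.
From mathcomp Require Import all_boot all_order all_algebra ring_quotient.
From mathcomp Require Import all_classical all_reals all_analysis.
From mathcomp Require Import freeg.
Set Implicit Arguments.
Unset Strict Implicit.
Unset Printing Implicit Defensive.
From mathcomp Require Import zify.
Import Order.TTheory GRing.Theory Num.Theory numFieldNormedType.Exports.
Local Open Scope ring_scope.

Section HomologyAt.
Variables (A B C : zmodType) (f : {additive A -> B}) (g : {additive B -> C}).

Definition cycle_pred : {pred B} := fun z => g z == 0.

Lemma cycle_zmod_closed : zmod_closed cycle_pred.
Proof.
split=> [|x y]; rewrite !unfold_in /cycle_pred ?raddf0 //.
by move=> /eqP gx /eqP gy; rewrite raddfB gx gy subrr.
Qed.

HB.instance Definition _ := GRing.isZmodClosed.Build B cycle_pred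
  cycle_zmod_closed.

Definition cycles := {z : B | z \in cycle_pred}.

HB.instance Definition _ := Choice.on cycles.
HB.instance Definition _ := SubType.on cycles.
HB.instance Definition _ := [SubChoice_isSubZmodule of cycles by <:].

Definition boundary_pred : {pred cycles} := fun z => `[< exists a, f a = val z >].

Lemma boundary_zmod_closed : zmod_closed boundary_pred.
Proof.
split=> [|x y]; first by apply/asboolP; exists 0; rewrite !raddf0.
move=> /asboolP[a fa] /asboolP[b fb]; apply/asboolP; exists (a - b).
by rewrite !raddfB fa fb.
Qed.

HB.instance Definition _ := GRing.isZmodClosed.Build cycles boundary_pred
  boundary_zmod_closed.

(* ker g / im f, for A --f--> B --g--> C *)
Definition homology_at : zmodType := Quotient.quot boundary_pred.

Lemma homology_at_eq0P :
  (forall x : homology_at, x = 0) <->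
  (forall z, g z = 0 -> exists a, f a = z).
Proof.
split=> [h0 z gz|gf x].
  have zcyc : z \in cycle_pred by apply/eqP.
  have := h0 (\pi_(Quotient.quot boundary_pred)%qT (Sub z zcyc : cycles)).
  move=> /eqP; rewrite -(raddf0 (\pi_(Quotient.quot boundary_pred))%qT).
  rewrite -Quotient.idealrBE subr0 => /asboolP[a fa].
  by exists a; rewrite fa SubK.
elim/quotW: x => z; apply/eqP.
rewrite -(raddf0 (\pi_(Quotient.quot boundary_pred))%qT) -Quotient.idealrBE.
by rewrite subr0; apply/asboolP/gf/eqP/(valP z).
Qed.

End HomologyAt.

Lemma alternating_sum0 (R : pzRingType) (V : lmodType R) n (G : nat -> nat -> V) :
  (forall i j, (i <= j)%N -> G i j.+1 = G j i) ->
  \sum_(j < n.+1) (-1) ^+ j *: (\sum_(i < n) (-1) ^+ i *: G i j) = 0.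
Proof.
move=> GS; pose H (i j : nat) := ((-1) ^+ (i + j) : R) *: G i j.
have -> : \sum_(j < n.+1) (-1) ^+ j *: (\sum_(i < n) (-1) ^+ i *: G i j) =
    \sum_(j < n.+1) \sum_(i < n | (i < j)%N) H i j +
    \sum_(j < n.+1) \sum_(i < n | (j <= i)%N) H i j.
  rewrite -big_split; apply: eq_bigr => j _ /=.
  rewrite scaler_sumr (bigID (fun i : 'I_n => (i < j)%N)) /=.
  by congr (_ + _); apply: eq_big => [i|i _];
    rewrite -?leqNgt // /H scalerA -exprD addnC.
rewrite big_ord_recl big_pred0 ?add0r//.
rewrite [X in _ + X]big_ord_recr /= [X in _ + (_ + X)]big_pred0 ?addr0 => [|i].
  rewrite [X in _ + X](exchange_big_dep xpredT) //= -big_split big1 //= => i _.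
  rewrite -big_split big1 //= => j; rewrite ltnS => ji.
  by rewrite /H GS // addnS exprS mulN1r scaleNr [(i + j)%N]addnC addNr.
by rewrite leqNgt ltn_ord.
Qed.

Section Nerve.
Variable M : monoidType.

(* With 0-based entries g_0, ..., g_k, the face d_i multiplies g_(i-1) and g_i;
   for i = 0 and i = k.+1 there is no such pair and d_i deletes g_0, resp. g_k. *)
Definition face k (i : nat) (g : k.+1.-tuple M) : k.-tuple M :=
  [tuple if (j.+1 < i)%N then nth 1%g g j
         else if j.+1 == i then (nth 1 g j * nth 1 g j.+1)%g
         else nth 1%g g j.+1 | j < k].

Lemma nth_face k i (g : k.+1.-tuple M) j : (j < k)%N ->
  nth 1%g (face i g) j =
  if (j.+1 < i)%N then nth 1%g g j
  else if j.+1 == i then (nth 1 g j * nth 1 g j.+1)%g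
  else nth 1%g g j.+1.
Proof.
by move=> jk; rewrite -[j]/(val (Ordinal jk)) -tnth_nth tnth_mktuple.
Qed.

Lemma face0 k (g : k.+1.-tuple M) : face 0 g = behead g :> seq M.
Proof.
apply: (@eq_from_nth _ 1%g) => [|j]; first by rewrite size_behead !size_tuple.
by rewrite size_tuple => jk; rewrite nth_face // nth_behead.
Qed.

Lemma face_inner k i (g : k.+1.-tuple M) : (i < k)%N ->
  face i.+1 g =
  take i g ++ (nth 1 g i * nth 1 g i.+1)%g :: drop i.+2 g :> seq M.
Proof.
move=> ik; have szi : size (take i g) = i by rewrite size_takel ?size_tuple; lia.
apply: (@eq_from_nth _ 1%g) => [|j].
  by rewrite size_tuple size_cat szi /= size_drop size_tuple; lia.
rewrite size_tuple => jk; rewrite nth_face // ltnS eqSS nth_cat szi.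
have [ji|ij|<-] := ltngtP j i; [by rewrite nth_take| |by rewrite subnn].
have -> : (j - i = (j - i.+1).+1)%N by lia.
by rewrite /= nth_drop; congr nth; lia.
Qed.

Lemma face_last k (g : k.+1.-tuple M) : face k.+1 g = take k g :> seq M.
Proof.
apply: (@eq_from_nth _ 1%g) => [|j]; first by rewrite size_takel !size_tuple.
by rewrite size_tuple => jk; rewrite nth_face // ltnS jk nth_take.
Qed.

Lemma face_face k i j (g : k.+2.-tuple M) : (i <= j)%N ->
  face i (face j.+1 g) = face j (face i g).
Proof.
move=> ij; apply: val_inj; apply: (@eq_from_nth _ 1%g) => [|l].
  by rewrite !size_tuple.
rewrite size_tuple => lk; rewrite !nth_face; try lia.
case: (ltngtP l.+1 i) => li; case: (ltngtP l.+2 i) => li'; 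
  case: (ltngtP l.+1 j) => lj; case: (ltngtP l.+1 j.+1) => lj';
  case: (ltngtP l.+2 j.+1) => lj''; rewrite ?mulgA //; lia.
Qed.

Definition chains k := {freeg (k.-tuple M) / int}.

HB.instance Definition _ k := GRing.Lmodule.on (chains k).

Definition boundary k : chains k.+1 -> chains k :=
  fglift (fun g => \sum_(i < k.+2) (-1) ^+ i *: << face i g >>).

Lemma boundary_is_zmod_morphism k : zmod_morphism (@boundary k).
Proof. exact: lift_is_additive. Qed.

HB.instance Definition _ k := GRing.isZmodMorphism.Build (chains k.+1)
  (chains k) (@boundary k) (@boundary_is_zmod_morphism k).

Lemma boundary_boundary k (c : chains k.+2) :
  boundary (boundary c) = 0.
Proof.
elim/freeg_ind_dom0: c => [|n g c _ _ IH]; first by rewrite !raddf0.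
rewrite !raddfD /= IH addr0 {2}/boundary liftU -[n]intz scaler_int !raddfMz.
have dd0 : boundary (\sum_(i < k.+3) (-1) ^+ i *: << face i g >> : chains k.+1) = 0.
  rewrite raddf_sum -[RHS](@alternating_sum0 int (chains k) k.+2
    (fun i j => << face i (face j g) >>)) => [|i j ij]; last by rewrite face_face.
  apply: eq_bigr => i _; rewrite raddfZsign; congr (_ *: _).
  exact: etrans (liftU _ _ _) (scale1r _).
by rewrite [X in X *~ _]dd0 mul0rz.
Qed.

(* C_{-1} = 0 is encoded by the zero map out of C_0. *)
Definition monoid_homology k : zmodType :=
  match k with
  | 0 => homology_at (@boundary 0) (\0 : {additive chains 0 -> chains 0})
  | n.+1 => homology_at (@boundary n.+1) (@boundary n)
  end.

Definition acyclic := forall k, (0 < k)%N -> forall x : monoid_homology k, x = 0.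

End Nerve.

Section Linfty.
Variables (R : realType) (X : Type).

Definition linfty_pred : {pred X -> R} := fun f => `[< bounded_fun f >].

Lemma linfty_predP (f : X -> R) :
  reflect (exists C, forall x, `|f x| <= C) (f \in linfty_pred).
Proof.
apply: (iffP (asboolP _)) => [[C [_ fC]]|[C fC]].
  by exists (C + 1) => x; apply: fC => //; rewrite ltrDl.
by exists C; split=> [|r Cr x _]; [exact: num_real|exact: le_trans (ltW Cr)].
Qed.

Lemma linfty_zmod_closed : zmod_closed linfty_pred.
Proof.
split=> [|f g /linfty_predP[C fC] /linfty_predP[D gD]]; apply/linfty_predP.
  by exists 0 => x; rewrite normr0.
by exists (C + D) => x; apply: le_trans (ler_normB _ _) (lerD (fC x) (gD x)).
Qed.

HB.instance Definition _ := GRing.isZmodClosed.Build (X -> R) linfty_pred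
  linfty_zmod_closed.

Definition linfty := {f : X -> R | f \in linfty_pred}.

HB.instance Definition _ := Choice.on linfty.
HB.instance Definition _ := SubType.on linfty.
HB.instance Definition _ := [SubChoice_isSubZmodule of linfty by <:].

End Linfty.

Section BoundedCohomology.
Variables (R : realType) (M : monoidType).

Definition cochains k := linfty R (k.-tuple M).

HB.instance Definition _ k := GRing.Zmodule.on (cochains k).

Definition coboundary_fun k (phi : cochains k) (g : k.+1.-tuple M) : R :=
  \sum_(i < k.+2) (-1) ^+ i * val phi (face i g).

Lemma coboundary_bounded k (phi : cochains k) :
  coboundary_fun phi \in @linfty_pred R (k.+1.-tuple M).
Proof.
have /linfty_predP[C phiC] := valP phi.
apply/linfty_predP; exists (\sum_(i < k.+2) C) => g.
apply: (le_trans (ler_norm_sum _ _ _)); apply: ler_sum => i _.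
by rewrite normrM normrX normrN1 expr1n mul1r.
Qed.

Definition coboundary k (phi : cochains k) : cochains k.+1 :=
  Sub (coboundary_fun phi) (coboundary_bounded phi).

Lemma coboundary_is_zmod_morphism k : zmod_morphism (@coboundary k).
Proof.
move=> phi psi; apply: val_inj; apply/funext => g.
transitivity (coboundary_fun phi g - coboundary_fun psi g); last by rewrite GRing.valB.
rewrite SubK /coboundary_fun -sumrB; apply: eq_bigr => i _.
by rewrite GRing.valB mulrBr.
Qed.

HB.instance Definition _ k := GRing.isZmodMorphism.Build (cochains k)
  (cochains k.+1) (@coboundary k) (@coboundary_is_zmod_morphism k).

Lemma coboundary_coboundary k (phi : cochains k) :
  coboundary (coboundary phi) = 0.
Proof.
apply: val_inj; apply/funext => g.
rewrite SubK /coboundary_fun.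
pose G i j : R^o := val phi (face i (face j g)).
apply: (@alternating_sum0 R R^o k.+2 G) => i j ij.
by rewrite /G face_face.
Qed.

Definition bounded_cohomology k : zmodType :=
  match k with
  | 0 => homology_at (\0 : {additive cochains 0 -> cochains 0}) (@coboundary 0)
  | n.+1 => homology_at (@coboundary n) (@coboundary n.+1)
  end.

Definition boundedly_acyclic :=
  forall k, (0 < k)%N -> forall x : bounded_cohomology k, x = 0.

End BoundedCohomology.

Section IncreasingMaps.

Definition increasing_pred : {pred nat -> nat} :=
  fun f => `[< {homo f : m n / (m < n)%N} >].

Definition emb_lt := {f : nat -> nat | f \in increasing_pred}.

HB.instance Definition _ := Choice.on emb_lt.
HB.instance Definition _ := SubType.on emb_lt.

Lemma emb_lt_one_subproof : idfun \in increasing_pred.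
Proof. exact/asboolP. Qed.

Lemma emb_lt_mul_subproof (eta zeta : emb_lt) :
  val zeta \o val eta \in increasing_pred.
Proof.
apply/asboolP => m n mn /=.
by have /asboolP := valP zeta; apply; have /asboolP := valP eta; apply.
Qed.

Definition emb_lt_one : emb_lt := Sub idfun emb_lt_one_subproof.

(* eta first, then zeta *)
Definition emb_lt_mul (eta zeta : emb_lt) : emb_lt :=
  Sub (val zeta \o val eta) (emb_lt_mul_subproof eta zeta).

Lemma emb_lt_mulA : associative emb_lt_mul.
Proof. by move=> f g h; apply: val_inj. Qed.

Lemma emb_lt_mul1 : left_id emb_lt_one emb_lt_mul.
Proof. by move=> f; apply: val_inj. Qed.

Lemma emb_lt_mulr1 : right_id emb_lt_one emb_lt_mul.
Proof. by move=> f; apply: val_inj. Qed.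

HB.instance Definition _ := isMonoid.Build emb_lt
  emb_lt_mulA emb_lt_mul1 emb_lt_mulr1.

End IncreasingMaps.

(* Main.v *)
Require Import Defs.
From mathcomp Require Import all_boot all_order all_algebra.
From mathcomp Require Import all_classical all_reals all_analysis.
From HB Require Import structures.
From mathcomp Require Import freeg zify lra.

Set Implicit Arguments.
Unset Strict Implicit.
Unset Printing Implicit Defensive.
Import Order.TTheory GRing.Theory Num.Theory.
Local Open Scope ring_scope.

(* Order a right-cancellative monoid M by x >= h x, and M x M likewise by the
   diagonal left action. Both order complexes carry a commuting right action, on
   M x M through the second factor, and the orbits of the first complex are the
   nerve. In the order complex of M x M every finite set of vertices can be
     pushed
   down monotonically below a single vertex: an element of M x M is an infinite
   chain of points in N x N, the order is inclusion, and one chain interleaves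
   subsequences of finitely many given ones. So this complex is acyclic, with
   fillings of uniformly bounded size, and the order complex of M maps to it
   equivariantly. The composite with either projection back to M has the same
   image in the nerve. With the second projection it is equivariantly homotopic
     to
   the identity; with the first it is invariant under the right action and
   contracts by coning off at 1. Hence the identity of the nerve is
     null-homotopic
   in positive degrees, each simplex using boundedly many simplices. *)

(** * Additive maps out of free abelian groups *)

Section Lin.
Variables (T : choiceType) (U : zmodType).

Definition lin (f : T -> U) (z : {freeg T / int}) : U :=
  fglift (f : T -> zmodule U) z.

Lemma lin_is_zmod_morphism f : zmod_morphism (lin f).
Proof. by move=> x y; exact: (@lift_is_additive int T (zmodule U) f). Qed.

HB.instance Definition _ f :=
  GRing.isZmodMorphism.Build {freeg T / int} U (lin f) (lin_is_zmod_morphism f).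

Lemma linU f x : lin f << x >> = f x.
Proof. by rewrite /lin liftU scale1r. Qed.

Lemma eq_additive_freeg (f g : {additive {freeg T / int} -> U}) :
  (forall x, f << x >> = g << x >>) -> f =1 g.
Proof.
move=> fg; elim/freeg_ind_dom0 => [|k x z _ _ IH]; first by rewrite !raddf0.
by rewrite !raddfD /= IH -[k]intz -freegU_mulz !raddfMz fg.
Qed.

End Lin.

(** * Chains with a bounded number of simplices *)

Section SignedSums.
Variable T : choiceType.
Implicit Types (P : pred T) (x : T) (z : {freeg T / int}).

Definition signed (p : bool * T) : {freeg T / int} := << p.2 >> *~ (-1) ^+ p.1.

(** A bound on the l1-norm together with a support condition. Repetitions and cancelling terms are
    allowed, so bounds simply add up. *)
Definition signed_sum (P : pred T) (n : nat) z :=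
  exists s : seq (bool * T),
    [/\ (size s <= n)%N, all (fun p => P p.2) s & z = \sum_(p <- s) signed p].

Lemma signed_sumW P Q m n z : (m <= n)%N -> {subset P <= Q} ->
  signed_sum P m z -> signed_sum Q n z.
Proof.
move=> mn PQ [s [sm sP ->]]; exists s; split=> //; first exact: leq_trans mn.
by apply: sub_all sP => p; apply: PQ.
Qed.

Lemma signed_sum0 P : signed_sum P 0 0.
Proof. by exists [::]; rewrite big_nil. Qed.

Lemma signed_sumU P x : P x -> signed_sum P 1 << x >>.
Proof. by move=> Px; exists [:: (false, x)]; rewrite /= Px big_seq1. Qed.

Lemma signed_sumD P m n y z :
  signed_sum P m y -> signed_sum P n z -> signed_sum P (m + n) (y + z).
Proof.
move=> [s [sm sP ->]] [t [tn tP ->]]; exists (s ++ t).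
by rewrite size_cat leq_add // all_cat sP tP big_cat.
Qed.

Lemma signed_sumN P n z : signed_sum P n z -> signed_sum P n (- z).
Proof.
move=> [s [sn sP ->]]; exists [seq (~~ p.1, p.2) | p <- s].
rewrite size_map all_map sn sP; split=> //.
rewrite big_map -sumrN; apply: eq_bigr => -[[] x] _ /=;
by rewrite /signed /= ?expr0 ?expr1 ?mulrNz ?opprK ?mulr1z.
Qed.

Lemma signed_sumB P m n y z :
  signed_sum P m y -> signed_sum P n z -> signed_sum P (m + n) (y - z).
Proof. by move=> ? /signed_sumN; apply: signed_sumD. Qed.

End SignedSums.

Lemma raddf_signed (T : choiceType) (U : zmodType)
  (f : {additive {freeg T / int} -> U}) p :
  f (signed p) = f << p.2 >> *~ (-1) ^+ p.1.
Proof. exact: raddfMz. Qed.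

Lemma signed_sum_lin (S T : choiceType) (P : pred S) (Q : pred T) m n
  (f : S -> {freeg T / int}) z :
  (forall x, P x -> signed_sum Q m (f x)) -> signed_sum P n z ->
  signed_sum Q (n * m) (lin f z).
Proof.
move=> fP [s [sn sP ->]]; apply: (@signed_sumW _ Q Q (size s * m)) => //.
  by rewrite leq_mul2r sn orbT.
elim: s sP {sn} => [_|[b x] s IH /= /andP[Px sP]].
  by rewrite big_nil raddf0; apply: signed_sum0.
rewrite big_cons raddfD mulSn; apply: signed_sumD; last exact: IH.
rewrite raddf_signed /= linU; case: b; rewrite /= ?expr0 ?expr1.
  by rewrite mulrN1z; apply/signed_sumN/fP.
by rewrite mulr1z; apply: fP.
Qed.

Lemma eq_additive_signed_sum (T : choiceType) (U : zmodType) (P : pred T)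
  (f g : {additive {freeg T / int} -> U}) n z :
  (forall x, P x -> f << x >> = g << x >>) -> signed_sum P n z -> f z = g z.
Proof.
move=> fg [s [_ sP ->]]; rewrite !raddf_sum.
apply: eq_big_seq => p /(allP sP) /fg fgp.
by rewrite !raddf_signed fgp.
Qed.

Lemma norm_lin_signed_sum (T : choiceType) (R : numDomainType) (P : pred T)
  (f : T -> R) C n z : 0 <= C -> (forall x, `|f x| <= C) ->
  signed_sum P n z -> `|lin f z| <= C *+ n.
Proof.
move=> C0 fC [s [sn _ ->]]; apply: (@le_trans _ _ (C *+ size s)); last first.
  by rewrite ler_wpMn2l.
elim: s {sn} => [|p s IH]; first by rewrite big_nil raddf0 normr0.
rewrite big_cons raddfD /= mulrS (le_trans (ler_normD _ _))// lerD//.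
by rewrite raddf_signed /= linU; case: p => -[] x /=;
  rewrite ?expr1 ?expr0 ?mulrN1z ?normrN ?mulr1z.
Qed.

(** * Augmented ordered chains *)

Section OrderedChains.
Variable T : choiceType.
Notation chain := {freeg (seq T) / int}.
Implicit Types (x : T) (l : seq T) (z : chain).

Definition cone x : chain -> chain := lin (fun l => << x :: l >>).
HB.instance Definition _ x := GRing.Additive.on (cone x).

(* The augmented complex: the boundary of a vertex is the empty simplex. *)
Fixpoint del_seq l : chain :=
  if l is x :: l' then << l' >> - cone x (del_seq l') else 0.

Definition del : chain -> chain := lin del_seq.
HB.instance Definition _ := GRing.Additive.on del.

Lemma coneU x l : cone x << l >> = << x :: l >>.
Proof. exact: linU. Qed.

Lemma del_nil : del << [::] >> = 0.
Proof. exact: linU. Qed.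

Lemma del_cone x z : del (cone x z) = z - cone x (del z).
Proof.
apply: (addIr (cone x (del z))); rewrite subrK; move: z.
apply: (eq_additive_freeg (f := (del \o cone x) \+ (cone x \o del))
  (g := idfun)) => l /=.
by rewrite coneU /del !linU subrK.
Qed.

Lemma del_cons x l : del << x :: l >> = << l >> - cone x (del << l >>).
Proof. by rewrite -coneU del_cone. Qed.

Lemma del_del z : del (del z) = 0.
Proof.
move: z; apply: (eq_additive_freeg (f := del \o del) (g := \0)) => /=.
elim=> [|x l IH]; first by rewrite del_nil raddf0.
by rewrite del_cons raddfB /= del_cone IH raddf0 subr0 subrr.
Qed.

Variable ge : rel T.
Hypothesis ge_trans : transitive ge.

Definition simplex k : pred (seq T) := fun l => sorted ge l && (size l == k).

Lemma simplex_cons x l k :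
  simplex k.+1 (x :: l) = path ge x l && (size l == k).
Proof. by []. Qed.

Lemma signed_sum_del_seq k l :
  simplex k l -> signed_sum (simplex k.-1) k (del << l >>).
Proof.
(* The recursion puts x back in front of the faces of the tail, so these must be known to start
   below x; when the first vertex of the tail is dropped, this is transitivity. *)
suff aux x l' : path ge x l' ->
    signed_sum (fun t => path ge x t && (size t == (size l').-1)) (size l')
    (del << l' >>).
  case: l => [|x l] /andP[gel /eqP sz]; rewrite -sz.
    by rewrite del_nil; apply: signed_sum0.
  rewrite del_cons -[X in signed_sum _ X _]add1n; apply: signed_sumB.
    by apply: signed_sumU; rewrite /simplex /= eqxx andbT (path_sorted gel).
  have := aux _ _ gel.
  move=> /(signed_sum_lin (f := fun l => << x :: l >>)
    (Q := simplex (size (x :: l)).-1) (m := 1)).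
  (* For an empty tail the truncated predecessor [0.-1] would give faces of the wrong size, but the
     boundary is 0. *)
  case: l {gel sz} => [|y l]; first by move=> _; rewrite del_nil raddf0;
    exists [::]; rewrite big_nil.
  rewrite muln1; apply=> t tP; apply: signed_sumU.
  by rewrite /= simplex_cons.
elim: l' x => [|y l' IH] x; first by rewrite del_nil => _; apply: signed_sum0.
move=> /= /andP[xy yl]; rewrite del_cons -[X in signed_sum _ X _]add1n;
  apply: signed_sumB.
  by apply: signed_sumU; rewrite eqxx andbT (path_le ge_trans xy).
have := IH y yl.
move=> /(signed_sum_lin (f := fun l => << y :: l >>)
    (Q := fun t => path ge x t && (size t == (size l'))) (m := 1)).
case: l' {yl IH} => [|y' l']; first by move=> _; rewrite del_nil raddf0;
    exists [::]; rewrite big_nil.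
rewrite muln1; apply=> t tP; apply: signed_sumU.
by rewrite /= xy.
Qed.

End OrderedChains.
Arguments del {T} z.
Arguments cone {T} x z.

Section Push.
Variables (S T : choiceType) (f : S -> T).

Definition push : {freeg (seq S) / int} -> {freeg (seq T) / int} :=
  lin (fun l => << map f l >>).
HB.instance Definition _ := GRing.Additive.on push.

Lemma pushU l : push << l >> = << map f l >>.
Proof. exact: linU. Qed.

Lemma push_cone x z : push (cone x z) = cone (f x) (push z).
Proof.
move: z; apply: (eq_additive_freeg (f := push \o cone x)
  (g := cone (f x) \o push)) => l /=.
by rewrite coneU !pushU coneU.
Qed.

Lemma push_del z : push (del z) = del (push z).
Proof.
move: z; apply: (eq_additive_freeg (f := push \o @del S)
  (g := @del T \o push)) => l /=.
elim: l => [|x l IH]; first by rewrite pushU !del_nil raddf0.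
by rewrite pushU /= !del_cons raddfB /= push_cone IH !pushU.
Qed.

Lemma signed_sum_push (P : pred (seq S)) (Q : pred (seq T)) n z :
  (forall l, P l -> Q (map f l)) -> signed_sum P n z -> signed_sum Q n (push z).
Proof.
move=> PQ zP; rewrite -[n]muln1; apply: signed_sum_lin zP => l Pl.
exact/signed_sumU/PQ.
Qed.

End Push.

Lemma push_push (S T U : choiceType) (f : S -> T) (g : T -> U) z :
  push g (push f z) = push (g \o f) z.
Proof.
move: z; apply: (eq_additive_freeg (f := push g \o push f)
  (g := push (g \o f))) => l /=.
by rewrite !pushU map_comp.
Qed.

(* Identities in free abelian groups, coefficientwise over the integers. *)
Ltac chain_lra :=
  apply/eqP/freeg_eqP => ?;
  repeat match goal with H : _ = _ :> {freeg _ / _} |- context [coeff ?t _] =>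
    move/(congr1 (coeff t)): H end;
  rewrite !(coeffD, coeffN) => *; lra.

(** * Prisms, cones and fillings of cycles *)

Section Fill.
Variable T : choiceType.
Notation chain := {freeg (seq T) / int}.
Implicit Types (x : T) (l : seq T) (z : chain).

Section Prism.
Variable r : T -> T.

(** The usual triangulation of the prism between l and [map r l]: the alternating sum of the lists
    x_0, ..., x_i, r x_i, ..., r x_k. *)
Fixpoint prism_seq l : chain :=
  if l is x :: l' then cone x (<< map r l >> - prism_seq l') else 0.

Definition prism : chain -> chain := lin prism_seq.
HB.instance Definition _ := GRing.Additive.on prism.

Lemma del_prism z : del (prism z) + prism (del z) = push r z - z.
Proof.
have prism_cone x y :
    prism (cone x y) = cone x (push r (cone x y)) - cone x (prism y).
  apply: (addIr (cone x (prism y))); rewrite subrK; move: y.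
  apply: (eq_additive_freeg (f := (prism \o cone x) \+ (cone x \o prism))
    (g := cone x \o (push r \o cone x))) => l /=.
  by rewrite coneU /prism !linU pushU /= raddfB /= subrK.
apply: (addIr z); rewrite subrK; move: z.
apply: (eq_additive_freeg (f := ((del \o prism) \+ (prism \o del)) \+ idfun)
  (g := push r)) => /=.
elim=> [|x l IH].
  by rewrite del_nil /prism linU !raddf0 pushU !add0r.
have := congr1 (cone x) IH; rewrite -!coneU !raddfD /= => IHx.
rewrite !(del_cone, prism_cone, raddfB) /= !(del_cone, prism_cone) -push_del
  del_cone !raddfB /=.
chain_lra.
Qed.

Variable ge : rel T.
Variable s : seq T.
Hypothesis r_homo : {in s &, forall x y, ge x y -> ge (r x) (r y)}.
Hypothesis ge_r : {in s, forall x, ge x (r x)}.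

Lemma path_map_in x l : x \in s -> all (mem s) l -> path ge x l ->
  path ge (r x) (map r l).
Proof.
elim: l x => //= y l IH x xs /andP[ys ls] /andP[xy yl].
by rewrite r_homo ?IH.
Qed.

Lemma signed_sum_prism_seq x l : all (mem s) l -> path ge x l ->
  signed_sum (fun t => path ge x t && (size t == (size l).+1)) (size l)
    (prism_seq l).
Proof.
elim: l x => [|y l IH] x; first by move=> _ _; apply: signed_sum0.
move=> /= /andP[ys ls] /andP[xy yl];
  rewrite raddfB /= coneU -[X in signed_sum _ X _]add1n.
apply: signed_sumB.
  apply: signed_sumU => /=.
  by rewrite xy ge_r // path_map_in //= size_map eqxx.
rewrite -[X in signed_sum _ X _]muln1;
  apply: signed_sum_lin (IH y ls yl) => t /andP[yt /eqP st].
by apply: signed_sumU; rewrite /= xy yt st eqxx.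
Qed.

Lemma signed_sum_prism k n z :
  signed_sum (fun l => simplex ge k l && all (mem s) l) n z ->
  signed_sum (simplex ge k.+1) (n * k) (prism z).
Proof.
apply: signed_sum_lin => l /andP[/andP[gel /eqP <-] ls].
case: l gel ls => [|x l] /= xl; first by move=> _; apply: signed_sum0.
move=> /andP[xs ls]; rewrite raddfB /= coneU -[X in signed_sum _ X _]add1n;
  apply: signed_sumB.
  by apply: signed_sumU; rewrite /simplex /= ge_r // path_map_in //= size_map
    eqxx.
rewrite -[X in signed_sum _ X _]muln1;
  apply: signed_sum_lin (signed_sum_prism_seq ls xl).
by move=> t /andP[xt /eqP st]; apply: signed_sumU;
  rewrite /simplex /= xt st eqxx.
Qed.

End Prism.

(** Monotonicity and [ge x (r x)] make the prism from s to its image consist of simplices;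
    [ge c (r x)] allows the image to be coned off at c. *)
Definition conable (ge : rel T) := forall s : seq T, exists c, exists r : T ->
  T,
  {in s &, forall x y, ge x y -> ge (r x) (r y)} /\
  {in s, forall x, ge x (r x) && ge c (r x)}.

Variable ge : rel T.
Hypothesis geP : conable ge.

(** Only finitely many vertices occur in a chain, so [conable] applies to them. *)
Lemma signed_sum_vertices (P : pred (seq T)) n z : signed_sum P n z ->
  exists s : seq T, signed_sum (fun l => P l && all (mem s) l) n z.
Proof.
move=> [t [tn tP zE]]; exists (flatten [seq p.2 | p <- t]), t; split=> //.
apply/allP => p pt; rewrite (allP tP) //=.
by apply/allP => x xp; apply/flattenP; exists p.2 => //; apply: map_f.
Qed.

(** The prism joins z to its image under r, which bounds its cone at c. The cone costs n simplices
    and the prism n * k, whatever the vertices of z are. *)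
Lemma exists_fill k n z : signed_sum (simplex ge k) n z -> del z = 0 ->
  exists w, signed_sum (simplex ge k.+1) (n * k.+1) w /\ del w = z.
Proof.
move=> /signed_sum_vertices[s zs] dz; have [c [r [r_homo cr]]] := geP s.
exists (cone c (push r z) - prism r z); split.
  rewrite mulnS; apply: signed_sumB; last first.
    by apply: signed_sum_prism zs => // x /cr /andP[].
  rewrite -[X in signed_sum _ X _]muln1;
    apply: (signed_sum_lin (P := fun l => simplex ge k l && path ge c l)).
    by move=> l /andP[/andP[_ /eqP lk] cl]; apply: signed_sumU;
      rewrite /simplex /= cl lk eqxx.
  apply: signed_sum_push zs => -[|x l] /andP[/andP[/= xl sl]].
    by rewrite /simplex /= sl.
  move=> /andP[xs ls]; rewrite /simplex /= size_map sl andbT.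
  have /andP[_ cx] := cr x xs.
  by rewrite cx (path_map_in r_homo).
rewrite raddfB /= del_cone -push_del dz !raddf0 addr0.
have := del_prism r z; rewrite dz raddf0 addr0 => ->.
by rewrite opprB addrC subrK.
Qed.

(** The default value 0 makes this total, so that [lift_chain] can be defined before the chains to
    be filled are known to be cycles. *)
Definition fill k n z : chain :=
  xget 0 [set w | signed_sum (simplex ge k.+1) (n * k.+1) w /\ del w =
    z]%classic.

Lemma fillP k n z : signed_sum (simplex ge k) n z -> del z = 0 ->
  signed_sum (simplex ge k.+1) (n * k.+1) (fill k n z) /\ del (fill k n z) = z.
Proof.
by move=> zP /(exists_fill zP) wP; exact: (@xgetPex _ 0
  [set w | signed_sum (simplex ge k.+1) (n * k.+1) w /\ del w = z]%classic).
Qed.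

End Fill.

(** * Right translation of simplices *)

Section Resolution.
Variable M : monoidType.
Hypothesis mulIm : forall m : M, injective (fun x : M => (x * m)%g).
Implicit Types (m x y : M) (u v : seq M) (e : M * M).

Definition mul_ge : rel M := fun x y => `[< exists h, y = (h * x)%g >].

Definition pair_ge : rel (M * M) :=
  fun e e' => `[< exists h, e' = (h * e.1, h * e.2)%g >].

(** Right cancellation makes h unique; the default 1 occurs when y is not below x. *)
Definition quo y x : M := xget 1%g [set h | y = (h * x)%g]%classic.

Lemma mulmK h x : quo (h * x)%g x = h.
Proof.
rewrite /quo; case: xgetP => [h' _ hh'|/(_ h)/(_ erefl)//].
exact: (mulIm (m := x) (esym hh')).
Qed.

Lemma quoK x y : mul_ge x y -> (quo y x * x)%g = y.
Proof. by move=> /asboolP[h ->]; rewrite mulmK. Qed.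

Lemma mul_ge1 y : mul_ge 1%g y.
Proof. by apply/asboolP; exists y; rewrite mulg1. Qed.

Lemma mul_ge_trans : transitive mul_ge.
Proof.
move=> y x z /asboolP[h ->] /asboolP[h' ->]; apply/asboolP; exists (h' * h)%g.
by rewrite mulgA.
Qed.

Lemma pair_ge_trans : transitive pair_ge.
Proof.
move=> y x z /asboolP[h ->] /asboolP[h' ->]; apply/asboolP; exists (h' * h)%g.
by rewrite !mulgA.
Qed.

Lemma mul_ge_mulr m x y : mul_ge (x * m)%g (y * m)%g = mul_ge x y.
Proof.
apply/asbool_equiv_eq; split=> -[h hE]; exists h.
  by apply: (mulIm (m := m)); rewrite hE mulgA.
by rewrite hE mulgA.
Qed.

Lemma quo_mulr m x y : mul_ge x y -> quo (y * m)%g (x * m)%g = quo y x.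
Proof. by move=> /asboolP[h ->]; rewrite -mulgA !mulmK. Qed.

Definition act2 m e : M * M := (e.1, e.2 * m)%g.

Lemma pair_ge_act2 m e e' : pair_ge (act2 m e) (act2 m e') = pair_ge e e'.
Proof.
case: e => a b; case: e' => a' b'; apply/asbool_equiv_eq;
  split=> -[h /=] [-> hE]; exists h.
  by congr (_, _); apply: (mulIm (m := m)); rewrite hE mulgA.
by rewrite hE /act2 /= mulgA.
Qed.

Lemma pair_ge1 e e' : pair_ge e e' -> mul_ge e.1 e'.1.
Proof. by move=> /asboolP[h ->]; apply/asboolP; exists h. Qed.

Lemma pair_ge2 e e' : pair_ge e e' -> mul_ge e.2 e'.2.
Proof. by move=> /asboolP[h ->]; apply/asboolP; exists h. Qed.

Lemma simplex_map (S T : choiceType) (geS : rel S) (geT : rel T) (f : S -> T) k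
  l :
  (forall a b, geS a b -> geT (f a) (f b)) ->
  simplex geS k l -> simplex geT k (map f l).
Proof.
by move=> fP /andP[/(homo_sorted fP) fl lk]; rewrite /simplex fl size_map.
Qed.

Lemma simplex_mulr m k u :
  simplex mul_ge k u -> simplex mul_ge k [seq (x * m)%g | x <- u].
Proof. by apply: simplex_map => x y; rewrite mul_ge_mulr. Qed.

Lemma simplex_cons1 k u : simplex mul_ge k u -> simplex mul_ge k.+1 (1%g :: u).
Proof.
case: u => [//|x u] /andP[xu /= sk].
by rewrite /simplex /= mul_ge1 [path _ _ _]xu eqSS sk.
Qed.

(** The simplex with top vertex 1 whose right translate by the top vertex of u is u. *)
Definition normalize u := [seq quo y (head 1%g u) | y <- u].

Lemma simplex_head_ge k u : simplex mul_ge k u -> {in u, forall y, mul_ge (head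
  1%g u) y}.
Proof.
case: u => // x u /andP[xu _] y; rewrite inE => /predU1P[->|yu] /=.
  by apply/asboolP; exists 1%g; rewrite mul1g.
exact: (allP (order_path_min mul_ge_trans xu)).
Qed.

Lemma normalizeK k u : simplex mul_ge k u ->
  [seq (y * head 1 u)%g | y <- normalize u] = u.
Proof.
move=> uP; rewrite -map_comp map_id_in // => y yu /=.
by rewrite quoK // (simplex_head_ge uP).
Qed.

Lemma simplex_normalize k u : simplex mul_ge k u -> simplex mul_ge k (normalize
  u).
Proof.
move=> uP; have /andP[] := uP; rewrite -{1}(normalizeK uP) sorted_map => su
  /eqP sk.
rewrite /simplex size_map sk eqxx andbT.
by apply: sub_sorted su => x y /=; rewrite mul_ge_mulr.
Qed.

Lemma normalize_mulr m k u : simplex mul_ge k u ->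
  normalize [seq (y * m)%g | y <- u] = normalize u.
Proof.
case: u => // x u /simplex_head_ge ux; rewrite /normalize -map_comp.
by apply/eq_in_map => y /ux xy /=; rewrite quo_mulr.
Qed.

Lemma signed_sum_push_mulr m k n z : signed_sum (simplex mul_ge k) n z ->
  signed_sum (simplex mul_ge k) n (push (fun x => x * m)%g z).
Proof. by apply: signed_sum_push => u; apply: simplex_mulr. Qed.

Section Extension.
Variables (T : choiceType) (act : M -> T -> T).
Hypothesis actM : forall m x, act (x * m)%g =1 act m \o act x.

(** Every nonempty simplex is a unique translate of one with top vertex 1, so an equivariant map may
    be prescribed freely on the latter. *)
Definition extend (f : seq M -> {freeg (seq T) / int}) u :=
  push (act (head 1%g u)) (f (normalize u)).

Lemma extend_mulr f m k u : simplex mul_ge k.+1 u ->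
  extend f [seq (y * m)%g | y <- u] = push (act m) (extend f u).
Proof.
move=> uP; rewrite /extend (normalize_mulr _ uP) push_push.
case: u uP => //= x u _; congr (lin _ _); apply/funext => l.
by congr << _ >>; apply: eq_map.
Qed.

Lemma extend_lin (f : seq M -> {freeg (seq T) / int}) m k n z :
  (forall v, simplex mul_ge k v ->
    f [seq (y * m)%g | y <- v] = push (act m) (f v)) ->
  signed_sum (simplex mul_ge k) n z ->
  lin f (push (fun x => x * m)%g z) = push (act m) (lin f z).
Proof.
move=> fP; apply: (eq_additive_signed_sum (f := lin f \o push (fun x => x *
  m)%g)
  (g := push (act m) \o lin f)) => v /fP /= fv.
by rewrite pushU !linU.
Qed.

End Extension.

(** * Equivariant lift to pairs, homotopy and contraction *)

Hypothesis pair_geP : conable pair_ge.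

Lemma act2M m x : act2 (x * m)%g =1 act2 m \o act2 x.
Proof. by move=> e; rewrite /act2 /= mulgA. Qed.

Lemma mulrM m x : (fun y : M => y * (x * m))%g =1 (fun y => y * m)%g \o (fun y
  => y * x)%g.
Proof. by move=> y; rewrite /= mulgA. Qed.

(** A simplex with j+1 vertices has j+1 faces, each lifted to [lift_size j] simplices at most;
    filling multiplies the total by j+1. *)
Fixpoint lift_size k := if k is j.+1 then (j.+1 * lift_size j * j.+1)%N else
  1%N.

(* A chain map from the order complex of [M] to that of [M * M] commuting with
   right translation, built on normalized simplices by acyclicity. *)
Fixpoint lift_chain k : seq M -> {freeg (seq (M * M)) / int} :=
  if k is j.+1 then
    extend act2 (fun v => fill pair_ge j (j.+1 * lift_size j)
                            (lin (lift_chain j) (del << v >>)))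
  else fun=> << [::] >>.

Lemma lift_chain_mulr m k u : simplex mul_ge k u ->
  lift_chain k [seq (y * m)%g | y <- u] = push (act2 m) (lift_chain k u).
Proof.
case: k => [|k] uP; first by rewrite /= pushU.
exact: (extend_mulr act2M _ _ uP).
Qed.

(** Both claims go through one induction: in lower degree they make the lifted boundary a cycle of
    bounded size, hence fillable. *)
Lemma lift_chain_spec k u : simplex mul_ge k u ->
  signed_sum (simplex pair_ge k) (lift_size k) (lift_chain k u) /\
  del (lift_chain k u) = lin (lift_chain k.-1) (del << u >>).
Proof.
elim: k u => [|k IH] u uP.
  case: u uP => [_|x u /andP[]//]; rewrite /= !del_nil raddf0; split=> //.
  exact: signed_sumU.
have vP := simplex_normalize uP; set v := normalize u in vP.
have dv : signed_sum (simplex mul_ge k) k.+1 (del << v >>).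
  exact: (signed_sum_del_seq mul_ge_trans vP).
have [||wP dw] := @fillP _ _ pair_geP k (k.+1 * lift_size k)
  (lin (lift_chain k) (del << v >>)).
- by apply: signed_sum_lin dv => t /IH[].
- rewrite -[RHS](raddf0 (lin (lift_chain k.-1))) -(del_del << v >>).
  apply: (eq_additive_signed_sum (f := del \o lin (lift_chain k))
    (g := lin (lift_chain k.-1) \o del)) dv => t /IH[_] /=.
  by rewrite linU.
split.
  by apply: signed_sum_push wP => t; apply: simplex_map => e e';
    rewrite pair_ge_act2.
(* Equivariance in the lower degree carries the equation from the normalized simplex v to its
   translate u. *)
rewrite -push_del dw -[k.+1.-1]/k -(extend_lin _ dv); last by move=> t;
  apply: lift_chain_mulr.
by rewrite push_del pushU (normalizeK uP).
Qed.

#[local] Arguments lift_chain : simpl never.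

Fixpoint homotopy_size k :=
  if k is j.+1 then (1 + lift_size j.+1 + j.+1 * homotopy_size j)%N else 0%N.

(** Joins the identity to the second projection of the lift. On a simplex with top vertex 1 the
    chain to be filled is coned off at 1, which lies above all of M. *)
Fixpoint homotopy k : seq M -> {freeg (seq M) / int} :=
  if k is j.+1 then
    extend (fun m y => y * m)%g
      (fun v => cone 1%g (<< v >> - push snd (lift_chain j.+1 v) -
                          lin (homotopy j) (del << v >>)))
  else fun=> 0.

Lemma homotopy_mulr m k u : simplex mul_ge k u ->
  homotopy k [seq (y * m)%g | y <- u] =
  push (fun y => y * m)%g (homotopy k u).
Proof.
case: k => [|k] uP; first by rewrite /= raddf0.
exact: (extend_mulr mulrM _ _ uP).
Qed.

Lemma signed_sum_cone1 k n z : signed_sum (simplex mul_ge k) n z ->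
  signed_sum (simplex mul_ge k.+1) n (cone 1%g z).
Proof.
move=> zP; rewrite -[n]muln1; apply: signed_sum_lin zP => t tP.
exact/signed_sumU/simplex_cons1.
Qed.

Lemma signed_sum_push_fst k n z : signed_sum (simplex pair_ge k) n z ->
  signed_sum (simplex mul_ge k) n (push fst z).
Proof. by apply: signed_sum_push => t; apply/simplex_map/pair_ge1. Qed.

Lemma signed_sum_push_snd k n z : signed_sum (simplex pair_ge k) n z ->
  signed_sum (simplex mul_ge k) n (push snd z).
Proof. by apply: signed_sum_push => t; apply/simplex_map/pair_ge2. Qed.

Lemma homotopy_spec k u : simplex mul_ge k u ->
  signed_sum (simplex mul_ge k.+1) (homotopy_size k) (homotopy k u) /\
  del (homotopy k u) =
    << u >> - push snd (lift_chain k u) - lin (homotopy k.-1) (del << u >>).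
Proof.
elim: k u => [|k IH] u uP.
  case: u uP => [_|x u /andP[]//];
    rewrite /= !del_nil !raddf0 /lift_chain pushU subrr addr0.
  by split=> //; apply: signed_sum0.
have vP := simplex_normalize uP; have := normalizeK uP.
set v := normalize u in vP *; set x := head _ u => vK.
have -> : homotopy k.+1 u = push (fun y => y * x)%g (cone 1%g
    (<< v >> - push snd (lift_chain k.+1 v) - lin (homotopy k) (del << v >>))).
  by [].
have dv : signed_sum (simplex mul_ge k) k.+1 (del << v >>).
  exact: (signed_sum_del_seq mul_ge_trans vP).
have [Fv dFv] := lift_chain_spec vP.
split.
  apply/signed_sum_push_mulr/signed_sum_cone1/signed_sumB.
    by apply: signed_sumB; [exact: signed_sumU|exact: signed_sum_push_snd].
  by apply: signed_sum_lin dv => t /IH[].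
(* The induction hypothesis on the cycle [del << v >>]; it makes the chain under the cone a cycle,
   so that the cone fills it. *)
have dQ : del (lin (homotopy k) (del << v >>)) =
    del << v >> - push snd (lin (lift_chain k) (del << v >>)).
  transitivity (del << v >> - push snd (lin (lift_chain k) (del << v >>)) -
    lin (homotopy k.-1) (del (del << v >>)));
      last by rewrite del_del raddf0 subr0.
  apply/eqP; rewrite -subr_eq opprK -subr_eq opprK; apply/eqP.
  apply: (eq_additive_signed_sum (g := idfun)
    (f := ((del \o lin (homotopy k)) \+ (lin (homotopy k.-1) \o del)) \+
      (push snd \o lin (lift_chain k)))) dv => t /IH[_] /=.
  by rewrite !linU => ->; rewrite !subrK.
rewrite -push_del del_cone !raddfB /= dQ -(push_del snd) dFv !raddfB /=.
have -> : push (fun y => y * x)%g (push snd (lift_chain k.+1 v)) = push snd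
  (lift_chain k.+1 u).
  rewrite -[in RHS]vK lift_chain_mulr // !push_push; congr (lin _ _).
have -> : push (fun y => y * x)%g (lin (homotopy k) (del << v >>)) = lin
  (homotopy k) (del << u >>).
  rewrite -(extend_lin (act := fun m y => (y * m)%g) (m := x) _ dv);
    last by move=> t; apply: homotopy_mulr.
  by rewrite push_del pushU vK.
rewrite pushU vK /=; chain_lra.
Qed.

Definition contraction k u : {freeg (seq M) / int} :=
  homotopy k u + cone 1%g (push fst (lift_chain k u)).

Lemma signed_sum_contraction k u : simplex mul_ge k u ->
  signed_sum (simplex mul_ge k.+1) (homotopy_size k + lift_size k) (contraction
    k u).
Proof.
move=> uP; have [Qu _] := homotopy_spec uP; have [Fu _] := lift_chain_spec uP.
exact/signed_sumD/signed_sum_cone1/signed_sum_push_fst.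
Qed.

(** The cone at 1 contributes the first projection, the homotopy the second; the two cancel once
    mapped to the nerve. *)
Lemma del_contraction k u : simplex mul_ge k u ->
  del (contraction k u) =
  << u >> - push snd (lift_chain k u) + push fst (lift_chain k u)
  - lin (contraction k.-1) (del << u >>).
Proof.
move=> uP; have [_ dQ] := homotopy_spec uP; have [_ dF] := lift_chain_spec uP.
have -> : lin (contraction k.-1) (del << u >>) =
    lin (homotopy k.-1) (del << u >>) +
    cone 1%g (push fst (lin (lift_chain k.-1) (del << u >>))).
  apply: (eq_additive_freeg (f := lin (contraction k.-1)) (g :=
    (lin (homotopy k.-1)) \+ (cone 1%g \o (push fst \o lin (lift_chain
      k.-1))))).
  by move=> t /=; rewrite !linU.
rewrite raddfD /= dQ del_cone -push_del dF.
chain_lra.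
Qed.

End Resolution.

Arguments lift_chain : simpl never.
Arguments homotopy : simpl never.

(** * Orbits of simplices and the nerve *)

Section DelSum.
Variable T : choiceType.
Implicit Types (x : T) (l : seq T).

Definition rem_nth i l := take i l ++ drop i.+1 l.

Lemma nth_rem_nth x0 i l m : nth x0 (rem_nth i l) m = nth x0 l (bump i m).
Proof.
rewrite /rem_nth nth_cat size_take /bump.
have [il|li] := ltnP i (size l).
  have [mi|im] := ltnP m i; first by rewrite nth_take.
  by rewrite nth_drop; congr nth; lia.
rewrite drop_oversize ?(leq_trans li) // take_oversize // nth_nil.
have [ml|lm] := ltnP m (size l); last by rewrite nth_default //; lia.
by rewrite (_ : (i <= m)%N = false) ?add0n //; lia.
Qed.

Lemma delE l : del << l >> = \sum_(i < size l) (-1) ^+ i *: << rem_nth i l >>.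
Proof.
elim: l => [|x l IH]; first by rewrite del_nil big_ord0.
rewrite del_cons big_ord_recl /= expr0 scale1r /rem_nth /= drop0; congr (_ + _).
rewrite IH raddf_sum -sumrN; apply: eq_bigr => i _.
rewrite /bump /= add1n exprS mulN1r scaleNr; congr (- _).
by rewrite raddfZsign /= coneU.
Qed.

End DelSum.

Section Quotients.
Variable M : monoidType.
Hypothesis mulIm : forall m : M, injective (fun x : M => (x * m)%g).
Implicit Types (m x y : M) (u v : seq M).

Lemma quo_quo x y z : mul_ge x y -> mul_ge y z -> (quo z y * quo y x)%g = quo z
  x.
Proof.
by move=> /asboolP[h ->] /asboolP[h' ->];
  rewrite !(mulmK mulIm) mulgA (mulmK mulIm).
Qed.

Lemma simplex_nth_ge k u i j : simplex (@mul_ge M) k u -> (i <= j < k)%N ->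
  mul_ge (nth 1%g u i) (nth 1%g u j).
Proof.
move=> /andP[su /eqP sk] /andP[ij jk].
apply: (sorted_leq_nth (@mul_ge_trans M) _ _ su) => //; rewrite ?inE ?sk //.
  by move=> x; apply/asboolP; exists 1%g; rewrite mul1g.
exact: leq_ltn_trans jk.
Qed.

(* Vertices are listed from the top of the order, whereas the nerve multiplies
   neighbouring entries in the order of composition; hence the reversal. *)
Definition quotients k u : k.-tuple M :=
  [tuple quo (nth 1%g u (k - i)) (nth 1%g u (k - i).-1) | i < k].

Lemma nth_quotients k u i : (i < k)%N ->
  nth 1%g (quotients k u) i = quo (nth 1%g u (k - i)) (nth 1%g u (k - i).-1).
Proof.
by move=> ik; rewrite -[i]/(val (Ordinal ik)) -tnth_nth tnth_mktuple.
Qed.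

Lemma eq_quotients k u (g : k.-tuple M) :
  (forall i, (i < k)%N -> quo (nth 1%g u (k - i)) (nth 1%g u (k - i).-1) = nth
    1%g g i) ->
  quotients k u = g.
Proof.
move=> ug; apply: val_inj; apply: (@eq_from_nth _ 1%g);
  rewrite !size_tuple // => i ik.
by rewrite nth_quotients // ug.
Qed.

Lemma quotients_mulr m k u : simplex (@mul_ge M) k.+1 u ->
  quotients k [seq (y * m)%g | y <- u] = quotients k u.
Proof.
move=> uP; have /andP[_ /eqP sk] := uP.
apply: eq_quotients => i ik; rewrite nth_quotients // !(nth_map 1%g) ?sk;
  try lia.
by rewrite (quo_mulr mulIm) // (simplex_nth_ge uP) //; lia.
Qed.

(** Consecutive pairs differ by one left factor h common to both coordinates, so the quotients
    agree. *)
Lemma quotients_fst_snd k (e : seq (M * M)) : simplex (@pair_ge M) k.+1 e ->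
  quotients k (map snd e) = quotients k (map fst e).
Proof.
move=> eP; have /andP[se /eqP sk] := eP.
apply: eq_quotients => i ik; rewrite nth_quotients // !(nth_map (1, 1)%g) ?sk;
  try lia.
have /asboolP[h ->] : pair_ge (nth (1, 1)%g e (k - i).-1) (nth (1, 1)%g e (k -
  i)).
  by apply: (sorted_ltn_nth (@pair_ge_trans M) _ se); rewrite ?inE ?sk; lia.
by rewrite !(mulmK mulIm).
Qed.

(** Dropping an inner vertex multiplies the two adjacent quotients, dropping an end vertex deletes
    one; the reversed listing turns i into k+1-i. *)
Lemma face_quotients k u i : simplex (@mul_ge M) k.+2 u -> (i < k.+2)%N ->
  face i (quotients k.+1 u) = quotients k (rem_nth (k.+1 - i) u).
Proof.
move=> uP ik; apply/esym/eq_quotients => j jk.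
rewrite nth_face // !nth_rem_nth !nth_quotients ?ltnS ?(ltnW jk) //.
have kj : (k.+1 - j)%N = (k - j).+1 by lia.
have kSj : (k.+1 - j.+1)%N = (k - j)%N by rewrite subSS.
rewrite kj kSj /= /bump.
case: ltngtP => ji.
- have -> : (k.+1 - i <= k - j)%N by lia.
  have -> : (k.+1 - i <= (k - j).-1)%N by lia.
  by rewrite !add1n prednK // subn_gt0.
- have -> : (k.+1 - i <= k - j)%N = false by lia.
  by have -> : (k.+1 - i <= (k - j).-1)%N = false by lia.
have -> : (k.+1 - i <= k - j)%N by lia.
have -> : (k.+1 - i <= (k - j).-1)%N = false by lia.
rewrite add1n add0n.
have ge1 : mul_ge (nth 1%g u (k - j).-1) (nth 1%g u (k - j)).
  by apply: (simplex_nth_ge uP); lia.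
have ge2 : mul_ge (nth 1%g u (k - j)) (nth 1%g u (k - j).+1).
  by apply: (simplex_nth_ge uP); lia.
by rewrite quo_quo.
Qed.

Definition nerve_chain k : {freeg (seq M) / int} -> chains M k :=
  lin (fun u => << quotients k u >>).
HB.instance Definition _ k := GRing.Additive.on (nerve_chain k).

Lemma nerve_chainU k u : nerve_chain k << u >> = << quotients k u >>.
Proof. exact: linU. Qed.

Lemma boundaryU k (g : k.+1.-tuple M) :
  boundary (<< g >> : chains M k.+1) = \sum_(i < k.+2) (-1) ^+ i *: << face i g
    >>.
Proof. exact: etrans (liftU _ _ _) (scale1r _). Qed.

(** The sign comes from the reversal i -> k+1-i of the faces. *)
Lemma boundary_nerve_chain k n z : signed_sum (simplex (@mul_ge M) k.+2) n z ->
  boundary (nerve_chain k.+1 z) = (-1) ^+ k.+1 *: nerve_chain k (del z).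
Proof.
have E u : simplex (@mul_ge M) k.+2 u ->
    boundary (nerve_chain k.+1 << u >>) = (-1) ^+ k.+1 *: nerve_chain k (del <<
      u >>).
  move=> uP; rewrite nerve_chainU boundaryU delE raddf_sum scaler_sumr.
  have /andP[_ /eqP ->] := uP; rewrite (reindex_inj rev_ord_inj) /=.
  apply: eq_bigr => i _; have ik : (i <= k.+1)%N by rewrite -ltnS ltn_ord.
  rewrite raddfZsign /= nerve_chainU subSS face_quotients ?ltnS ?leq_subr //
    subKn //.
  by rewrite scalerA -exprD -signr_odd -[in RHS]signr_odd oddD oddB.
apply: (eq_additive_signed_sum (f := @boundary M k \o nerve_chain k.+1)
  (g := *:%R ((-1) ^+ k.+1) \o (nerve_chain k \o del))) => u /E.
exact.
Qed.

Definition prodg (s : seq M) : M := foldr (fun x y => x * y)%g 1%g s.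

(** The simplex over g with top vertex 1: its i-th vertex is the product of the last i entries of
    g. *)
Definition vertices k (g : k.-tuple M) : seq M :=
  mkseq (fun i => prodg (drop (k - i) g)) k.+1.

Lemma simplex_vertices k (g : k.-tuple M) : simplex (@mul_ge M) k.+1 (vertices
  g).
Proof.
rewrite /simplex size_mkseq eqxx andbT; apply/(sortedP 1%g) => i.
rewrite size_mkseq => ik; rewrite !nth_mkseq //; last by lia.
apply/asboolP; exists (nth 1%g g (k - i.+1)).
rewrite (drop_nth 1%g) ?size_tuple; last by lia.
by rewrite (_ : (k - i.+1).+1 = k - i)%N //; lia.
Qed.

Lemma quotients_vertices k (g : k.-tuple M) : quotients k (vertices g) = g.
Proof.
apply: eq_quotients => i ik; rewrite !nth_mkseq; try lia.
rewrite (_ : k - (k - i) = i)%N; last by lia.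
rewrite (_ : k - (k - i).-1 = i.+1)%N; last by lia.
by rewrite (drop_nth 1%g) ?size_tuple //= (mulmK mulIm).
Qed.

(** Products of consecutive quotients telescope. *)
Lemma vertices_quotients k u : simplex (@mul_ge M) k.+1 u ->
  [seq (y * head 1 u)%g | y <- vertices (quotients k u)] = u.
Proof.
move=> uP; have /andP[_ /eqP sk] := uP.
apply: (@eq_from_nth _ 1%g) => [|i]; first by rewrite size_map size_mkseq sk.
rewrite size_map size_mkseq => ik; rewrite (nth_map 1%g) ?size_mkseq //.
rewrite nth_mkseq // -nth0.
elim: i ik => [|i IH] ik.
  by rewrite subn0 drop_oversize ?size_tuple //= mul1g.
rewrite (drop_nth 1%g) ?size_tuple /=; last by lia.
rewrite (_ : (k - i.+1).+1 = k - i)%N; last by lia.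
rewrite -mulgA IH ?(ltnW ik) // nth_quotients; last by lia.
by rewrite subKn // quoK // (simplex_nth_ge uP) //= leqnSn.
Qed.

End Quotients.

Lemma lin_sign (T : choiceType) (R : pzRingType) (f : T -> R) i (z : {freeg T /
  int}) :
  lin f ((-1) ^+ i *: z) = (-1) ^+ i * lin f z.
Proof.
rewrite -signr_odd -[in RHS]signr_odd; case: odd; rewrite ?expr0 ?expr1.
  by rewrite scaleN1r raddfN mulN1r.
by rewrite scale1r mul1r.
Qed.

(** * Contraction of the nerve, homology and bounded cohomology *)

Section Acyclicity.
Variable M : monoidType.
Hypothesis mulIm : forall m : M, injective (fun x : M => (x * m)%g).
Hypothesis pair_geP : conable (@pair_ge M).

Definition nerve_contraction k (g : k.-tuple M) : chains M k.+1 :=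
  nerve_chain k.+1 (contraction k.+1 (vertices g)).

Lemma nerve_chain_mulr m k n z : signed_sum (simplex (@mul_ge M) k.+1) n z ->
  nerve_chain k (push (fun y => y * m)%g z) = nerve_chain k z.
Proof.
apply: (eq_additive_signed_sum (f := nerve_chain k \o push (fun y => y * m)%g)
  (g := nerve_chain k)) => u uP /=.
by rewrite pushU !nerve_chainU (quotients_mulr mulIm).
Qed.

(** The homotopy term is translated, which the nerve does not see; the cone term does not change, as
    [act2] fixes the first factor and the apex is 1. *)
Lemma nerve_chain_contraction_mulr m k u : simplex (@mul_ge M) k.+1 u ->
  nerve_chain k.+1 (contraction k.+1 [seq (y * m)%g | y <- u]) =
  nerve_chain k.+1 (contraction k.+1 u).
Proof.
move=> uP; have [Qu _] := homotopy_spec mulIm pair_geP uP.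
rewrite /contraction !raddfD /= (homotopy_mulr mulIm _ uP) (nerve_chain_mulr _
  Qu).
by rewrite (lift_chain_mulr mulIm _ uP) push_push.
Qed.

Lemma nerve_contraction_quotients k u : simplex (@mul_ge M) k.+1 u ->
  nerve_contraction (quotients k u) = nerve_chain k.+1 (contraction k.+1 u).
Proof.
move=> uP; rewrite -{2}(vertices_quotients mulIm uP).
by rewrite nerve_chain_contraction_mulr // simplex_vertices.
Qed.

Lemma boundary_nerve_contraction k (g : k.+1.-tuple M) :
  boundary (nerve_contraction g) =
  (-1) ^+ k *: << g >> + lin (@nerve_contraction k) (boundary (<< g >> : chains
    M k.+1)).
Proof.
set u := vertices g; have uP : simplex (@mul_ge M) k.+2 u by apply:
  simplex_vertices.
have [Fu _] := lift_chain_spec mulIm pair_geP uP.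
rewrite (boundary_nerve_chain mulIm (signed_sum_contraction mulIm pair_geP uP)).
rewrite (del_contraction mulIm pair_geP uP) !raddfB raddfD /= raddfB /=.
(* The two projections of the lift cancel here, leaving g and the contraction of its boundary. *)
have -> : nerve_chain k.+1 (push snd (lift_chain k.+2 u)) =
          nerve_chain k.+1 (push fst (lift_chain k.+2 u)).
  apply: (eq_additive_signed_sum (f := nerve_chain k.+1 \o push snd)
    (g := nerve_chain k.+1 \o push fst)) Fu => e eP /=.
  by rewrite !pushU !nerve_chainU (quotients_fst_snd mulIm).
rewrite subrK nerve_chainU (quotients_vertices mulIm).
have -> : << g >> = nerve_chain k.+1 << u >>.
  by rewrite nerve_chainU (quotients_vertices mulIm).
have uu : signed_sum (simplex (@mul_ge M) k.+2) 1 << u >> by apply: signed_sumU.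
rewrite (boundary_nerve_chain mulIm uu) (raddfZsign (lin (@nerve_contraction
  k))) /=.
have -> : lin (@nerve_contraction k) (nerve_chain k (del << u >>)) =
    nerve_chain k.+1 (lin (contraction k.+1) (del << u >>)).
  apply: (eq_additive_signed_sum (f := lin (@nerve_contraction k) \o
    nerve_chain k)
    (g := nerve_chain k.+1 \o lin (contraction k.+1)))
    (signed_sum_del_seq (@mul_ge_trans M) uP) => v vP /=.
  by rewrite nerve_chainU !linU nerve_contraction_quotients.
by rewrite !exprS !mulN1r opprK !scaleNr.
Qed.

Lemma boundary_lin_nerve_contraction k (z : chains M k.+1) :
  boundary (lin (@nerve_contraction k.+1) z) =
  (-1) ^+ k *: z + lin (@nerve_contraction k) (boundary z).
Proof.
have -> : (-1) ^+ k *: z = lin (fun g : k.+1.-tuple M => (-1) ^+ k *: << g >>)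
  z.
  rewrite -signr_odd; case: odd; rewrite ?expr0 ?expr1.
    rewrite scaleN1r; move: z; apply: (eq_additive_freeg (f := \- idfun)) => g
      /=.
    by rewrite linU scaleN1r.
  rewrite scale1r; move: z; apply: (eq_additive_freeg (f := idfun)) => g /=.
  by rewrite linU scale1r.
move: z; apply: (eq_additive_freeg (f := @boundary M k.+1 \o lin
  (@nerve_contraction k.+1))
  (g := (lin _) \+ (lin (@nerve_contraction k) \o @boundary M k))) => g /=.
by rewrite !linU boundary_nerve_contraction.
Qed.

Lemma acyclic_conable : acyclic M.
Proof.
case=> [//|k] _; apply/homology_at_eq0P => z dz.
exists ((-1) ^+ k *: lin (@nerve_contraction k.+1) z).
rewrite raddfZsign /= boundary_lin_nerve_contraction dz raddf0 addr0 scalerA.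
by rewrite -exprD -signr_odd addnn odd_double scale1r.
Qed.

(** A bound uniform in g, so that the dual operator preserves bounded cochains. *)
Lemma nerve_contraction_bounded k : exists n, forall g : k.-tuple M,
  signed_sum predT n (nerve_contraction g).
Proof.
exists ((homotopy_size k.+1 + lift_size k.+1) * 1)%N => g.
apply: signed_sum_lin (signed_sum_contraction mulIm pair_geP (simplex_vertices
  g)).
by move=> u _; apply: signed_sumU.
Qed.

Section Cochains.
Variable R : realType.

Lemma coboundary_lin k (phi : cochains R M k) (z : chains M k.+1) :
  lin (val (coboundary phi)) z = lin (val phi) (boundary z).
Proof.
move: z; apply: (eq_additive_freeg (g := lin (val phi) \o @boundary M k)) => g
  /=.
rewrite linU boundaryU raddf_sum /=; transitivity (coboundary_fun phi g) => //.
by apply: eq_bigr => i _; rewrite lin_sign linU.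
Qed.

Lemma cochain_contraction_bounded k (phi : cochains R M k.+1) :
  (fun g : k.-tuple M => (-1) ^+ k.+1 * lin (val phi) (nerve_contraction g)) \in
  @linfty_pred R (k.-tuple M).
Proof.
have /linfty_predP[C phiC] := valP phi.
have C0 : 0 <= C by apply: le_trans (normr_ge0 _) (phiC (nseq_tuple _ 1%g)).
have [n nP] := nerve_contraction_bounded k.
apply/linfty_predP; exists (C *+ n) => g.
rewrite normrM normrX normrN1 expr1n mul1r.
exact: norm_lin_signed_sum C0 phiC (nP g).
Qed.

Lemma boundedly_acyclic_conable : boundedly_acyclic R M.
Proof.
case=> [//|k] _; apply/homology_at_eq0P => phi dphi.
pose psi : cochains R M k :=
  exist (fun f => f \in @linfty_pred R _) _ (cochain_contraction_bounded phi).
exists psi; apply: val_inj; apply/funext => g.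
transitivity (coboundary_fun psi g) => //; rewrite /coboundary_fun /=.
under eq_bigr do rewrite mulrCA.
rewrite -mulr_sumr.
(* Applying phi to this identity, the left side becomes the value of the coboundary of phi on the
   contraction, which is 0. *)
have := boundary_nerve_contraction g.
move=> /(congr1 (lin (val phi)));
  rewrite raddfD /= -coboundary_lin dphi lin_sign linU.
rewrite boundaryU !raddf_sum /=.
under [X in _ = _ + X -> _]eq_bigr do rewrite raddfZsign /= lin_sign linU.
rewrite [X in X = _ -> _](_ : _ = 0); last first.
  pose f0 : {additive chains M k.+2 -> R} := \0.
  by apply: (eq_additive_freeg (g := f0)) => h /=; rewrite linU.
move=> /esym/eqP; rewrite addrC addr_eq0 => /eqP ->.
by rewrite mulrN mulrA -exprD addSn exprS mulN1r mulNr opprK -signr_odd addnn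
  odd_double mul1r.
Qed.

End Cochains.
End Acyclicity.

(** * Interleaving chains of points in N x N *)

Section IncreasingEmbeddings.
Implicit Types (f g h : emb_lt) (e : emb_lt * emb_lt).

Lemma emb_ltP f : {homo val f : m n / (m < n)%N}.
Proof. exact/asboolP/(valP f). Qed.

Lemma emb_lt_mono f : {mono val f : m n / (m < n)%N}.
Proof. exact/leqW_mono/leq_mono/emb_ltP. Qed.

Lemma emb_lt_inj f : injective (val f).
Proof. exact/incn_inj/leq_mono/emb_ltP. Qed.

Lemma emb_lt_ge f n : (n <= val f n)%N.
Proof. by elim: n => // n IH; exact: leq_ltn_trans IH (emb_ltP f (ltnSn n)).
  Qed.

Definition Emb (u : nat -> nat) (uP : {homo u : m n / (m < n)%N}) : emb_lt :=
  exist (fun v : nat -> nat => v \in increasing_pred) u (asboolT uP).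

Lemma emb_lt_mulIm f : injective (fun g : emb_lt => (g * f)%g).
Proof.
move=> g h /(congr1 val) gh; apply: val_inj; apply/funext => n.
by apply: (@emb_lt_inj f); have := congr1 (@^~ n) gh.
Qed.

Lemma pair_geP e e' :
  reflect (forall n, exists j, val e.1 j = val e'.1 n /\ val e.2 j = val e'.2 n)
    (pair_ge e e').
Proof.
apply: (iffP (asboolP _)) => [[h ->] n|/choice[h hP]];
  first by exists (val h n).
(* The reindexing h is increasing because [e.1] reflects the strict order. *)
have hlt : {homo h : m n / (m < n)%N}.
  by move=> m n mn; rewrite -(emb_lt_mono e.1) !(proj1 (hP _)); apply: emb_ltP.
exists (Emb hlt); rewrite [LHS]surjective_pairing.
by congr (_, _); apply: val_inj; apply/funext => n /=; have [] := hP n.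
Qed.

Lemma infinite_enumeration (P : pred nat) : (forall m, exists n, (m <= n)%N &&
  P n) ->
  exists f, (forall n, P (val f n)) /\ (forall m, P m -> exists n, val f n = m).
Proof.
move=> Pinf; pose next m := ex_minn (Pinf m).
have nextP m : [/\ (m <= next m)%N, P (next m) & forall n, (m <= n)%N -> P n ->
  (next m <= n)%N].
  rewrite /next; case: ex_minnP => n /andP[mn Pn] n_min; split=> // k mk Pk.
  by apply: n_min; rewrite mk.
pose fix nu n := if n is n'.+1 then next (nu n').+1 else next 0%N.
have nuP : {homo nu : m n / (m < n)%N}.
  by apply: homo_ltn => [|n]; [exact: ltn_trans|have [] := nextP (nu n).+1].
exists (Emb nuP); split=> [[|n]|m Pm] /=;
  [by have [] := nextP 0%N|by have [] := nextP (nu n).+1|].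
(* Descending from index m to the first index whose value reaches m, minimality of [next] gives the
   value m. *)
have : (m <= nu m)%N by exact: emb_lt_ge (Emb nuP) m.
elim: {2}m => [|n IH] mn.
  by exists 0%N; apply/eqP; rewrite eqn_leq mn andbT; have [_ _] := nextP 0%N;
    apply.
have [/IH//|nm] := leqP m (nu n).
by exists n.+1; apply/eqP; rewrite eqn_leq mn andbT;
  have [_ _] := nextP (nu n).+1; apply.
Qed.

(** The chain c takes its n-th point from [e n], and r x keeps the points of c with [e n] below x.
    They lie on x, are infinitely many as x recurs in e, and for y below x those kept for y are kept
    for x. *)
Lemma conable_emb_lt : conable (@pair_ge emb_lt).
Proof.
move=> s; have [->|s0] := eqVneq s [::]; first by exists (1, 1)%g, id.
have sz : (0 < size s)%N by case: s s0.
pose e n := nth (1, 1)%g s (n %% size s).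
have es n : e n \in s by rewrite mem_nth // ltn_mod.
(* The pairs (c n) are chosen one after the other, the n-th one from [e n]. *)
pose fix k n :=
  if n is n'.+1 then (maxn (val (e n').1 (k n')) (val (e n').2 (k n'))).+1 else
    0%N.
have c1P : {homo (fun n => val (e n).1 (k n)) : m n / (m < n)%N}.
  apply: homo_ltn => [|n]; first exact: ltn_trans.
  by apply: leq_trans (emb_lt_ge _ _); rewrite /= ltnS leq_maxl.
have c2P : {homo (fun n => val (e n).2 (k n)) : m n / (m < n)%N}.
  apply: homo_ltn => [|n]; first exact: ltn_trans.
  by apply: leq_trans (emb_lt_ge _ _); rewrite /= ltnS leq_maxr.
pose c := (Emb c1P, Emb c2P).
have nuP x : exists f, x \in s -> (forall n, pair_ge x (e (val f n))) /\
    (forall m, pair_ge x (e m) -> exists n, val f n = m).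
  have [xs|] := boolP (x \in s); last by exists 1%g.
  have [|f fP] := @infinite_enumeration (fun n => pair_ge x (e n));
    last by exists f.
  (* This index is at least m and reduces modulo [size s] to the position of x, so e takes the value
     x there. *)
  move=> m; exists (m * size s + index x s)%N.
  rewrite (leq_trans (leq_pmulr m sz)) ?leq_addr //= /e modnMDl modn_small
    ?index_mem //.
  by rewrite nth_index //; apply/pair_geP => n; exists n.
have [nu {}nuP] := choice nuP.
exists c, (fun x => (nu x * c.1, nu x * c.2)%g); split=> [x y xs ys xy|x xs].
  have [_ nux] := nuP x xs; have [nuy _] := nuP y ys.
  apply/pair_geP => n.
  have [j jn] := nux (val (nu y) n) (pair_ge_trans xy (nuy n)).
  by exists j; rewrite /= jn.
apply/andP; split; last by apply/asboolP; exists (nu x).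
have [nux _] := nuP x xs; apply/pair_geP => n.
by have /pair_geP/(_ (k (val (nu x) n))) := nux n.
Qed.

End IncreasingEmbeddings.

Theorem theorem4 (R : realType) :
  acyclic emb_lt /\ boundedly_acyclic R emb_lt.
Proof.
split.
  exact: acyclic_conable emb_lt_mulIm conable_emb_lt.
exact: (@boundedly_acyclic_conable _ emb_lt_mulIm conable_emb_lt R).
Qed.
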